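(* Let $\Gamma$ be a finite simplicial graph such that the right-angled Artin group $\mathcal{A}_\Gamma$ is directly irreducible, freely irreducible and non-cyclic. Then there exists an amalgamated product splitting $\mathcal{A}_\Gamma=\mathcal{A}_+\ast_{\mathcal{A}_0}\mathcal{A}_-$, with $\mathcal{A}_\pm$ and $\mathcal{A}_0$ parabolic subgroups of $\mathcal{A}_\Gamma$, such that the corresponding Bass--Serre tree $\mathcal{A}_\Gamma\curvearrowright T$ is $U_0(\mathcal{A}_\Gamma)$-invariant. That is: for every $\varphi\in U_0(\mathcal{A}_\Gamma)$, there exists an isometry $f\colon T\to T$ satisfying $f\circ g=\varphi(g)\circ f$ for all $g\in\mathcal{A}_\Gamma$.
   Context: A group is directly (respectively freely) irreducible if it does not split as a direct (respectively free) product of two nontrivial groups. A parabolic subgroup of $\mathcal{A}_\Gamma$ is a conjugate of a subgroup $\mathcal{A}_\Delta$ generated by the vertices of a full subgraph $\Delta\subseteq\Gamma$. As usual, an amalgamated product splitting is understood to be nontrivial ($\mathcal{A}_0\ne\mathcal{A}_+$ and $\mathcal{A}_0\neq\mathcal{A}_-$). $U_0(\mathcal{A}_\Gamma)\le\mathrm{Aut}\,\mathcal{A}_\Gamma$ is the subgroup generated by the following automorphisms. Inversions: for $v\in\Gamma^{(0)}$, $v\mapsto v^{-1}$, all other standard generators fixed. Partial conjugations: for $w\in\Gamma^{(0)}$ and a connected component $C$ of $\Gamma\setminus\mathrm{st}\,w$, $u\mapsto w^{-1}uw$ for $u\in C^{(0)}$, all other standard generators fixed. Folds: for distinct non-adjacent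 $v,w\in\Gamma^{(0)}$ with $\mathrm{lk}\,v\subseteq\mathrm{lk}\,w$, $v\mapsto vw$, all other standard generators fixed. *)

(* Defs.v *)
From HB Require Import structures.
From mathcomp Require Import all_boot.
From mathcomp Require Import mathcomp_extra boolp classical_sets.

Set Implicit Arguments.
Unset Strict Implicit.
Unset Printing Implicit Defensive.

Local Open Scope classical_set_scope.
Local Open Scope group_scope.
Local Open Scope quotient_scope.

Record sgraph := SGraph {
  vertex :> finType;
  adj : rel vertex;
  adj_sym : symmetric adj;
  adj_irrefl : irreflexive adj
}.

Section Graphs.
Variable Gamma : sgraph.
Implicit Types (v w : Gamma) (X C : {set Gamma}).

Definition link v : {set Gamma} := [set u | adj v u]%SET.
Definition star v : {set Gamma} := v |: link v.

(* C is the vertex set of a connected component of the full subgraph on X. *)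
Definition component X C : Prop :=
  exists2 c, c \in X
    & C = [set u | connect [rel x y | [&& x \in X, y \in X & adj x y]] c u]%SET.

End Graphs.

Section Raag.
Variable Gamma : sgraph.

(* (v, true) stands for v and (v, false) for v^-1. *)
Definition word := seq (Gamma * bool).

Implicit Types s t : word.

(* The congruence on words whose quotient is the group
   < Gamma^(0) | v w = w v for v adjacent to w >. *)
Inductive word_eq : word -> word -> Prop :=
| WordRefl s : word_eq s s
| WordSym s t : word_eq s t -> word_eq t s
| WordTrans s t u : word_eq s t -> word_eq t u -> word_eq s u
| WordCat s s' t t' :
    word_eq s s' -> word_eq t t' -> word_eq (s ++ t) (s' ++ t')
| WordCancel v b : word_eq [:: (v, b); (v, ~~ b)] [::]
| WordComm v w : adj v w ->
    word_eq [:: (v, true); (w, true)] [:: (w, true); (v, true)].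

Definition word_eqb : rel word := fun s t => `[< word_eq s t >].

Lemma word_eqb_refl : reflexive word_eqb.
Proof. by move=> s; apply/asboolP; apply: WordRefl. Qed.

Lemma word_eqb_sym : symmetric word_eqb.
Proof. by move=> s t; apply/asboolP/asboolP => /WordSym. Qed.

Lemma word_eqb_trans : transitive word_eqb.
Proof.
move=> t s u /asboolP st /asboolP tu.
by apply/asboolP; apply: WordTrans st tu.
Qed.

Canonical word_equiv :=
  EquivRel word_eqb word_eqb_refl word_eqb_sym word_eqb_trans.

Definition raag := {eq_quot word_equiv}.

HB.instance Definition _ := Choice.on raag.
HB.instance Definition _ := EqQuotient.on raag.

Lemma raag_eqP s t : \pi_raag s = \pi_raag t <-> word_eq s t.
Proof.
split; first by move/eqmodP/asboolP.
by move=> st; apply/eqmodP/asboolP.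
Qed.

Definition winv s : word := rev [seq (x.1, ~~ x.2) | x <- s].

Lemma winvVg s : word_eq (winv s ++ s) [::].
Proof.
elim: s => [|[v b] s IHs]; first exact: WordRefl.
rewrite /winv /= rev_cons cat_rcons.
apply: (@WordTrans _ (winv s ++ s)) => //.
apply: WordCat; first exact: WordRefl.
change (word_eq ([:: (v, ~~ b); (v, b)] ++ s) ([::] ++ s)).
apply: WordCat; last exact: WordRefl.
by have := WordCancel v (~~ b); rewrite negbK.
Qed.

Lemma winvK : involutive winv.
Proof.
move=> s; rewrite /winv map_rev revK -map_comp -[RHS]map_id.
by apply: eq_map => -[v b] /=; rewrite negbK.
Qed.

Lemma winv_eq s t : word_eq s t -> word_eq (winv s) (winv t).
Proof.
move=> st; have lt : word_eq (winv s ++ (s ++ winv t)) (winv t).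
  rewrite catA -[X in word_eq _ X]cat0s.
  by apply: WordCat; [exact: winvVg | exact: WordRefl].
apply: WordTrans lt; rewrite -[X in word_eq X _]cats0.
apply: WordCat; first exact: WordRefl.
apply: WordSym; apply: (@WordTrans _ (t ++ winv t)).
  by apply: WordCat => //; apply: WordRefl.
by have := winvVg (winv t); rewrite winvK.
Qed.

Definition raag_mul (x y : raag) : raag := \pi_raag (repr x ++ repr y).
Definition raag_one : raag := \pi_raag [::].
Definition raag_inv (x : raag) : raag := \pi_raag (winv (repr x)).

Lemma raag_mulE s t : raag_mul (\pi_raag s) (\pi_raag t) = \pi_raag (s ++ t).
Proof. by apply/raag_eqP; apply: WordCat; apply/raag_eqP; rewrite reprK. Qed.

Lemma raag_invE s : raag_inv (\pi_raag s) = \pi_raag (winv s).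
Proof. by apply/raag_eqP/winv_eq/raag_eqP; rewrite reprK. Qed.

Lemma raag_mulA : associative raag_mul.
Proof.
elim/quotW=> x; elim/quotW=> y; elim/quotW=> z.
by rewrite (raag_mulE y z) (raag_mulE x y) !raag_mulE catA.
Qed.

Lemma raag_mul1g : left_id raag_one raag_mul.
Proof. by elim/quotW=> x; rewrite raag_mulE. Qed.

Lemma raag_mulg1 : right_id raag_one raag_mul.
Proof. by elim/quotW=> x; rewrite raag_mulE cats0. Qed.

Lemma raag_mulVg : left_inverse raag_one raag_inv raag_mul.
Proof.
elim/quotW=> x; rewrite raag_invE raag_mulE.
by apply/raag_eqP; apply: winvVg.
Qed.

Lemma raag_mulgV : right_inverse raag_one raag_inv raag_mul.
Proof.
elim/quotW=> x; rewrite raag_invE raag_mulE; apply/raag_eqP.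
by have := winvVg (winv x); rewrite winvK.
Qed.

HB.instance Definition _ := isGroup.Build raag
  raag_mulA raag_mul1g raag_mulg1 raag_mulVg raag_mulgV.

Definition std_gen (v : Gamma) : raag := \pi_raag [:: (v, true)].

End Raag.

Section Groups.
Variable G : groupType.
Implicit Types (A B C S : set G) (g : G).

Definition is_subgroup A : Prop :=
  A 1 /\ (forall x y, A x -> A y -> A (x / y)).

Definition generated S : set G := smallest is_subgroup S.

Definition conj_set A g : set G := [set x ^ g | x in A].

Definition lcoset_set g A : set G := [set g * a | a in A].

Definition cyclic_group : Prop :=
  exists g, forall x, exists n : nat, x = g ^+ n \/ x = g ^- n.

Definition trivial_group : Prop := forall x : G, x = 1.

Definition multiplicative_on A (L : groupType) (f : G -> L) : Prop :=
  forall x y, A x -> A y -> f (x * y) = f x * f y.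

(* G is the pushout of the inclusions of A0 into the subgroups Ap and Am.
   A homomorphism defined on a subgroup is represented by a function on G of
   which only the values on that subgroup matter. *)
Definition is_amalgam A0 Ap Am : Prop :=
  [/\ [/\ is_subgroup A0, is_subgroup Ap & is_subgroup Am],
      A0 `<=` Ap, A0 `<=` Am &
      forall (L : groupType) (f g : G -> L),
        multiplicative_on Ap f -> multiplicative_on Am g ->
        (forall x, A0 x -> f x = g x) ->
        let extends (h : {multiplicative G -> L}) :=
          (forall x, Ap x -> h x = f x) /\ (forall x, Am x -> h x = g x) in
        (exists h, extends h) /\
        (forall h h', extends h -> extends h' -> h =1 h')].

Definition amalgam_splitting A0 Ap Am : Prop :=
  [/\ is_amalgam A0 Ap Am, A0 <> Ap & A0 <> Am].

End Groups.

Definition isomorphic (G H : groupType) : Prop :=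
  exists f : {multiplicative G -> H}, bijective f.

Definition directly_irreducible (G : groupType) : Prop :=
  forall H K : groupType,
    isomorphic G (H * K)%type -> trivial_group H \/ trivial_group K.

(* G is the coproduct of H and K, with coprojections i and j. *)
Definition is_free_product (G H K : groupType)
    (i : {multiplicative H -> G}) (j : {multiplicative K -> G}) : Prop :=
  forall (L : groupType)
    (f : {multiplicative H -> L}) (g : {multiplicative K -> L}),
    let extends (h : {multiplicative G -> L}) := h \o i =1 f /\ h \o j =1 g in
    (exists h, extends h) /\
    (forall h h', extends h -> extends h' -> h =1 h').

Definition freely_irreducible (G : groupType) : Prop :=
  forall (H K : groupType)
    (i : {multiplicative H -> G}) (j : {multiplicative K -> G}),
    is_free_product i j -> trivial_group H \/ trivial_group K.

Section Aut.
Variable G : groupType.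

Record aut := Aut {
  aut_fun :> G -> G;
  autM : forall x y, aut_fun (x * y) = aut_fun x * aut_fun y;
  aut_bij : bijective aut_fun
}.

HB.instance Definition _ := gen_eqMixin aut.
HB.instance Definition _ := gen_choiceMixin aut.

Lemma aut_ext (f g : aut) : f =1 g -> f = g.
Proof.
case: f g => [f fM fb] [g gM gb] /= /funext fg; case: _ / fg gM gb => gM gb.
by congr Aut; apply: Prop_irrelevance.
Qed.

Definition aut_one : aut :=
  @Aut id (fun _ _ => erefl) (Bijective (frefl _) (frefl _)).

Lemma aut_mulM (f g : aut) x y : (f \o g) (x * y) = (f \o g) x * (f \o g) y.
Proof. by rewrite /= !autM. Qed.

Definition aut_mul (f g : aut) : aut :=
  Aut (aut_mulM f g) (bij_comp (aut_bij f) (aut_bij g)).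

Lemma aut_inv_subproof (f : aut) : exists g : aut,
  cancel (f : G -> G) g /\ cancel (g : G -> G) f.
Proof.
have [g fK gK] := aut_bij f.
have gM x y : g (x * y) = g x * g y.
  by apply: (bij_inj (aut_bij f)); rewrite autM !gK.
by exists (Aut gM (Bijective gK fK)).
Qed.

Definition aut_inv (f : aut) : aut := sval (cid (aut_inv_subproof f)).

Lemma aut_invK (f : aut) :
  cancel (f : G -> G) (aut_inv f) /\ cancel (aut_inv f : G -> G) f.
Proof. exact: svalP (cid (aut_inv_subproof f)). Qed.

Lemma aut_mulA : associative aut_mul.
Proof. by move=> f g h; apply: aut_ext. Qed.

Lemma aut_mul1g : left_id aut_one aut_mul.
Proof. by move=> f; apply: aut_ext. Qed.

Lemma aut_mulg1 : right_id aut_one aut_mul.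
Proof. by move=> f; apply: aut_ext. Qed.

Lemma aut_mulVg : left_inverse aut_one aut_inv aut_mul.
Proof. by move=> f; apply: aut_ext => x; apply: (aut_invK f).1. Qed.

Lemma aut_mulgV : right_inverse aut_one aut_inv aut_mul.
Proof. by move=> f; apply: aut_ext => x; apply: (aut_invK f).2. Qed.

HB.instance Definition _ := isGroup.Build aut
  aut_mulA aut_mul1g aut_mulg1 aut_mulVg aut_mulgV.

End Aut.

Section RaagNotions.
Variable Gamma : sgraph.
Local Notation A := (raag Gamma).
Local Notation gen := (@std_gen Gamma).

Definition std_parabolic (Delta : {set Gamma}) : set A :=
  generated [set gen v | v in [set v | v \in Delta]].

Definition parabolic (P : set A) : Prop :=
  exists (Delta : {set Gamma}) (g : A), P = conj_set (std_parabolic Delta) g.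

(* An automorphism is determined by its values on the standard generators. *)
Definition inversion (phi : aut A) : Prop :=
  exists v : Gamma, phi (gen v) = (gen v)^-1 /\
    forall u, u != v -> phi (gen u) = gen u.

Definition partial_conjugation (phi : aut A) : Prop :=
  exists (w : Gamma) (C : {set Gamma}),
    [/\ component (~: star w) C,
        forall u, u \in C -> phi (gen u) = (gen w)^-1 * gen u * gen w &
        forall u, u \notin C -> phi (gen u) = gen u].

Definition fold (phi : aut A) : Prop :=
  exists v w : Gamma,
    [/\ v != w, ~~ adj v w, link v \subset link w,
        phi (gen v) = gen v * gen w &
        forall u, u != v -> phi (gen u) = gen u].

Definition U0 : set (aut A) :=
  generated [set phi | inversion phi \/ partial_conjugation phi \/ fold phi].

End RaagNotions.

Section GraphMetric.
Variables (V : Type) (E : V -> V -> Prop).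

Inductive walk : nat -> V -> V -> Prop :=
| Walk0 x : walk 0 x x
| WalkS n x y z : E x y -> walk n y z -> walk n.+1 x z.

(* The distance between x and y in the graph (V, E) is n. *)
Definition graph_dist x y n : Prop :=
  walk n x y /\ forall m, walk m x y -> n <= m.

Definition graph_isometry (f : V -> V) : Prop :=
  bijective f /\
  forall x y n, graph_dist x y n <-> graph_dist (f x) (f y) n.

End GraphMetric.

Section BassSerre.
Variables (G : groupType) (A0 Ap Am : set G).

Definition bs_side (s : bool) : set G := if s then Ap else Am.

(* The vertex set is the disjoint union of G / Ap (s = true) and
   G / Am (s = false), the edge set is G / A0. *)
Record bs_vertex := BSVertex {
  bs_type : bool;
  bs_coset : set G;
  _ : exists g, bs_coset = lcoset_set g (bs_side bs_type)
}.

Record bs_edge := BSEdge {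
  bs_edge_coset : set G;
  _ : exists g, bs_edge_coset = lcoset_set g A0
}.

(* The edge g A0 has endpoints g Ap and g Am; for A0 contained in Ap and Am,
   these are the vertices whose cosets contain g A0. *)
Definition bs_incident (e : bs_edge) (x : bs_vertex) : Prop :=
  bs_edge_coset e `<=` bs_coset x.

Definition bs_adj (x y : bs_vertex) : Prop :=
  bs_type x <> bs_type y /\ exists e, bs_incident e x /\ bs_incident e y.

Lemma bs_act_subproof (h : G) (x : bs_vertex) :
  exists g, lcoset_set h (bs_coset x) = lcoset_set g (bs_side (bs_type x)).
Proof.
case: x => s X /= [g ->]; exists (h * g); rewrite /lcoset_set.
apply/seteqP; split=> [_ [_ [a aA <-] <-]|_ [a aA <-]].
  by exists a; rewrite ?mulgA.
by exists (g * a); rewrite ?mulgA //; exists a.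
Qed.

Definition bs_act (h : G) (x : bs_vertex) : bs_vertex :=
  BSVertex (bs_act_subproof h x).

End BassSerre.

Arguments bs_vertex {G} Ap Am.
Arguments bs_adj {G} A0 Ap Am x y.

(* Main.v *)
Require Import Defs.
From HB Require Import structures.
From mathcomp Require Import all_boot.
From mathcomp Require Import mathcomp_extra boolp classical_sets.

(** Call a set of vertices C a core if it spans a connected subgraph and each of
    its elements has a neighbour in C, and let N(C) be the set of all vertices
    with a neighbour in C; then N(C) contains C. The parabolic subgroup on N(C)
    is rigid under the generators of U_0 that multiply or conjugate by a vertex
    w outside N(C):

    - no fold v |-> vw has v in N(C), because a neighbour of v in C would have
      to be a neighbour of w ([core_fold]);
    - C avoids st w and is connected, so N(C) minus st w lies in a single
      component of the complement of st w, and a partial conjugation by w acts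
      on N(C) as the identity or as conjugation by w ([core_component]).

    If w lies in N(C), both kinds of automorphism preserve the parabolic
    subgroup on N(C) because they multiply by one of its elements. Inversions
    preserve every standard parabolic subgroup.

    Suppose that C and D are cores such that the complements P of N(C) and M of
    N(D) are nonempty, disjoint and not joined by any edge. Then N(C) and N(D)
    cover the graph and A is the amalgam of the parabolic subgroups on N(D) and
    N(C) over the one on their intersection ([std_parabolic_splitting]). A
    vertex w is missing from at most one of N(C) and N(D), so for each generator
    phi of U_0 there is a single element g such that x |-> phi(x)^g preserves all
    three parabolic subgroups ([U0_generator_carries]). The automorphisms with
    this property form a group, and for each of them X |-> phi(X) g permutes
    the cosets of the three subgroups: this is the isometry of the Bass--Serre
    tree ([bs_map_isometry]).

    It remains to find C and D ([exists_splitting_cores]). Irreducibility says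
    that the graph and its complement are connected. The latter provides an edge
    {v, y} with N({v, y}) different from the whole graph, so there is a maximal
    core D with this property. Each vertex of N(D) minus D is adjacent to
    everything in M, since otherwise it could be added to D. As the complement
    graph is connected, some n in N(D) minus D has a non-neighbour z outside
    N(D) minus D, and z must lie in D. Pick m in M and put C = {m, n}: then z is
    outside N(C), while N(C) contains N(D) minus D and M, so that P is contained
    in D and hence disjoint from M and not adjacent to it. *)

Set Implicit Arguments.
Unset Strict Implicit.
Unset Printing Implicit Defensive.

Local Open Scope classical_set_scope.
Local Open Scope group_scope.
Local Open Scope quotient_scope.

(** * Subgroups and homomorphisms *)

Section Subgroups.
Variable G : groupType.
Implicit Types A S : set G.

Lemma subgroupV A x : is_subgroup A -> A x -> A x^-1.
Proof. by move=> [A1 AF] Ax; rewrite -div1g; apply: AF. Qed.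

Lemma subgroupM A x y : is_subgroup A -> A x -> A y -> A (x * y).
Proof.
move=> sA Ax Ay; rewrite -[y]invgK; case: (sA) => _; apply=> //.
exact: subgroupV.
Qed.

Lemma subgroupJ A g x : is_subgroup A -> A g -> A (x ^ g) <-> A x.
Proof.
have aux h y : is_subgroup A -> A h -> A y -> A (y ^ h).
  move=> sA Ah Ay; rewrite conjgE.
  by apply: subgroupM; [|exact: subgroupV | exact: subgroupM].
move=> sA Ag; split=> [Axg|]; last exact: aux.
by rewrite -[x](conjgK g); apply: aux => //; apply: subgroupV.
Qed.

Lemma generated_subgroup S : is_subgroup (generated S).
Proof.
split=> [A [[A1 _] _]|x y xS yS A [sA SA]]; first exact: A1.
by case: (sA) => _; apply; [apply: xS | apply: yS].
Qed.

Lemma sub_generated S : S `<=` generated S.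
Proof. exact: sub_gen_smallest. Qed.

Lemma generated_min A S : is_subgroup A -> S `<=` A -> generated S `<=` A.
Proof. exact: smallest_sub. Qed.

End Subgroups.

Section Homomorphisms.
Variables (G L : groupType).

Lemma hom1 (h : {multiplicative G -> L}) : h 1 = 1.
Proof. by apply: (mulgI (h 1)); rewrite -gmulfM !mulg1. Qed.

Lemma homF (h : {multiplicative G -> L}) x y : h (x / y) = h x / h y.
Proof. by apply: (mulIg (h y)); rewrite -gmulfM !mulgVK. Qed.

Lemma homV (h : {multiplicative G -> L}) x : h x^-1 = (h x)^-1.
Proof. by rewrite -div1g homF hom1 div1g. Qed.

(** This equalizer reduces the comparison of h and f on A to generators of A. *)
Lemma multiplicative_on_subgroup A (f : G -> L) (h : {multiplicative G -> L}) :
  is_subgroup A -> multiplicative_on A f ->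
  is_subgroup [set x | A x /\ h x = f x].
Proof.
move=> sA fM; have [A1 AF] := sA; split=> [|x y [Ax hx] [Ay hy]] /=.
  split=> //; rewrite hom1; apply: (mulgI (f 1)).
  by rewrite -fM // !mulg1.
split; first exact: AF.
apply: (mulIg (h y)); rewrite homF mulgVK hx hy -fM ?mulgVK //.
exact: AF.
Qed.

End Homomorphisms.

Lemma homJ (G L : groupType) (h : {multiplicative G -> L}) x y :
  h (x ^ y) = h x ^ h y.
Proof. by rewrite !conjgE !gmulfM homV. Qed.

HB.instance Definition _ (G : groupType) (f : aut G) :=
  isMultiplicative.Build G G f (autM f).

(** * Right-angled Artin groups and standard parabolic subgroups *)

Section Raag.
Variable Gamma : sgraph.
Local Notation A := (raag Gamma).
Local Notation gen := (@std_gen Gamma).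
Implicit Types (v w : Gamma) (Delta : {set Gamma}).

Lemma gen_comm v w : adj v w -> commute (gen v) (gen w).
Proof.
by move=> vw; rewrite /commute [LHS]raag_mulE [RHS]raag_mulE;
   apply/raag_eqP/WordComm.
Qed.

Lemma raag_ind (P : set A) : is_subgroup P -> (forall v, P (gen v)) ->
  forall x, P x.
Proof.
move=> sP Pgen; elim/quotW; elim=> [|[v b] s IHs]; first by case: sP.
have -> : \pi_A ((v, b) :: s) = \pi_A [:: (v, b)] * \pi_A s.
  by rewrite [RHS]raag_mulE.
apply: subgroupM => //; case: b; first exact: Pgen.
have -> : \pi_A [:: (v, false)] = (gen v)^-1 by rewrite [RHS]raag_invE.
exact: subgroupV.
Qed.

Lemma raag_hom_ext (L : groupType) (h h' : {multiplicative A -> L}) :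
  (forall v, h (gen v) = h' (gen v)) -> h =1 h'.
Proof.
move=> hh'; apply: raag_ind => //=; split=> [|x y /= hx hy].
  by rewrite /= !hom1.
by rewrite !homF hx hy.
Qed.

(** The universal property of the presentation: evaluating words in L respects
    each of the relations that generate [word_eq]. *)
Lemma raag_hom_exists (L : groupType) (e : Gamma -> L) :
  (forall v w, adj v w -> commute (e v) (e w)) ->
  exists h : {multiplicative A -> L}, forall v, h (gen v) = e v.
Proof.
move=> eC; pose val (x : Gamma * bool) := if x.2 then e x.1 else (e x.1)^-1.
pose eval (s : word Gamma) := \prod_(x <- s) val x.
have evalE s t : word_eq s t -> eval s = eval t.
  rewrite /eval; elim=> //=.
  - by move=> ? ? ? _ -> _ ->.
  - by move=> ? ? ? ? _ IH1 _ IH2; rewrite !big_cat /= IH1 IH2.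
  - by move=> v [] /=; rewrite !big_cons !big_nil mulg1 ?mulgV ?mulVg.
  - by move=> v w vw; rewrite !big_cons !big_nil !mulg1 /=; apply: eC.
pose h (x : A) := eval (repr x).
have hpi s : h (\pi_A s) = eval s by apply/evalE/raag_eqP; rewrite reprK.
have hM x y : h (x * y) = h x * h y.
  elim/quotW: x => s; elim/quotW: y => t.
  by rewrite -[_ * _]/(raag_mul _ _) raag_mulE !hpi /eval big_cat.
pose hm := isMultiplicative.Build A L h hM.
exists (HB.pack_for {multiplicative A -> L} h hm) => v /=.
by rewrite hpi /eval big_seq1.
Qed.

Lemma std_parabolic_subgroup Delta : is_subgroup (std_parabolic Delta).
Proof. exact: generated_subgroup. Qed.

Lemma std_parabolic_gen Delta v : v \in Delta -> std_parabolic Delta (gen v).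
Proof. by move=> vD; apply: sub_generated; exists v. Qed.

Lemma std_parabolic_min Delta (P : set A) : is_subgroup P ->
  (forall v, v \in Delta -> P (gen v)) -> std_parabolic Delta `<=` P.
Proof. by move=> sP Pgen; apply: generated_min => // _ [v vD <-]; apply: Pgen. Qed.

Lemma std_parabolicS Delta Delta' : Delta \subset Delta' ->
  std_parabolic Delta `<=` std_parabolic Delta'.
Proof.
move=> /fintype.subsetP sD; apply: std_parabolic_min => [|v /sD].
  exact: std_parabolic_subgroup.
exact: std_parabolic_gen.
Qed.

Lemma std_parabolic_parabolic Delta : parabolic (std_parabolic Delta).
Proof.
exists Delta, 1; apply/seteqP; split=> [x xD|_ [x xD <-]].
  by exists x; rewrite // conjg1.
by rewrite conjg1.
Qed.

(** The exponent of v modulo 2, a homomorphism to Z/2. It separates the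
    generator v from the standard parabolic subgroup on any set without v. *)
Definition letter_parity v (x : A) : bool :=
  odd (count (fun l => l.1 == v) (repr x)).

Lemma letter_parity_pi v s :
  letter_parity v (\pi_A s) = odd (count (fun l => l.1 == v) s).
Proof.
have: word_eq (repr (\pi_A s)) s by apply/raag_eqP; rewrite reprK.
rewrite /letter_parity; move: (repr _) => t; elim=> //= {s t}.
- by move=> ? ? ? _ -> _ ->.
- by move=> ? ? ? ? _ IH1 _ IH2; rewrite !count_cat !oddD IH1 IH2.
- by move=> w b; case: (w == v).
- by move=> w w' _; rewrite !addn0 addnC.
Qed.

Lemma letter_parity_gen v w : letter_parity v (gen w) = (w == v).
Proof. by rewrite letter_parity_pi /= addn0 oddb. Qed.

Lemma letter_parityM v x y :
  letter_parity v (x * y) = letter_parity v x (+) letter_parity v y.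
Proof.
elim/quotW: x => s; elim/quotW: y => t.
by rewrite -[_ * _]/(raag_mul _ _) raag_mulE !letter_parity_pi count_cat oddD.
Qed.

Lemma letter_parity1 v : letter_parity v 1 = false.
Proof. by rewrite -[1]/(raag_one _) letter_parity_pi. Qed.

Lemma gen_neq1 v : gen v <> 1.
Proof.
move=> /(congr1 (letter_parity v)).
by rewrite letter_parity_gen letter_parity1 eqxx.
Qed.

Lemma notin_std_parabolic Delta v :
  v \notin Delta -> ~ std_parabolic Delta (gen v).
Proof.
move=> vD; suff sub : std_parabolic Delta `<=` [set x | letter_parity v x = false].
  by move=> /sub /=; rewrite letter_parity_gen eqxx.
apply: std_parabolic_min => [|w wD] /=.
  split=> [|x y /= x0 y0]; first exact: letter_parity1.
  by move: x0; rewrite -{1}[x](mulgVK y) letter_parityM y0 addbF.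
by rewrite letter_parity_gen; apply: contraNF vD => /eqP <-.
Qed.

End Raag.
(** * Irreducibility and connectedness *)

Section Cuts.
Variable T : finType.

(** Connectedness of the graph r on D, in the form in which it is used: every cut
    that separates two points of D is crossed by an edge. *)
Definition cut_connected (r : rel T) (D : {set T}) : Prop :=
  forall (S : {set T}) x y, x \in D -> y \in D -> x \in S -> y \notin S ->
  exists a b, [/\ a \in D, b \in D, a \in S, b \notin S & r a b].

End Cuts.

Section Induced.
Variables (Gamma : sgraph) (S : {set Gamma}).
Local Notation gen := (@std_gen Gamma).

Definition induced_adj : rel {v : Gamma | v \in S} :=
  fun x y => adj (val x) (val y).

Lemma induced_adj_sym : symmetric induced_adj.
Proof. by move=> x y; apply: adj_sym. Qed.

Lemma induced_adj_irrefl : irreflexive induced_adj.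
Proof. by move=> x; apply: adj_irrefl. Qed.

Definition induced : sgraph := SGraph induced_adj_sym induced_adj_irrefl.

Lemma induced_nontrivial v : v \in S -> ~ trivial_group (raag induced).
Proof.
by move=> vS /(_ (std_gen (exist _ v vS : induced))); apply: gen_neq1.
Qed.

Lemma induced_inclusion : exists i : {multiplicative raag induced -> raag Gamma},
  forall v : induced, i (std_gen v) = gen (val v).
Proof.
by apply: raag_hom_exists => v w vw; apply: (@gen_comm Gamma (val v) (val w)).
Qed.

Lemma induced_retraction : exists r : {multiplicative raag Gamma -> raag induced},
  (forall v : induced, r (gen (val v)) = std_gen v) /\
  (forall v, v \notin S -> r (gen v) = 1).
Proof.
have [|r rE] := @raag_hom_exists Gamma (raag induced)
    (fun v => if insub v is Some u then std_gen (u : induced) else 1).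
  move=> v w vw; case: insubP => [v' _ v'E|_]; last exact/commute_sym/commute1.
  case: insubP => [w' _ w'E|_]; last exact: commute1.
  by rewrite /=; apply: gen_comm; rewrite /= /induced_adj v'E w'E.
exists r; split=> [v|v vS]; rewrite rE; first by rewrite valK.
by rewrite insubN.
Qed.

End Induced.

Section Irreducibility.
Variable Gamma : sgraph.
Local Notation A := (raag Gamma).
Local Notation gen := (@std_gen Gamma).

(** If no edge crosses a cut, then the group is the coproduct of the groups of
    the two sides, since every relation involves only one side. *)
Lemma freely_irreducible_connected :
  freely_irreducible A -> cut_connected (@adj Gamma) [set: Gamma].
Proof.
move=> fi S x y _ _ xS yS; apply: contrapT => noedge.
have sep v w : adj v w -> (v \in S) = (w \in S).
  move=> vw; apply/idP/idP => [vS|wS]; apply: contrapT => /negP nS.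
    by apply: noedge; exists v, w; rewrite !inE.
  by apply: noedge; exists w, v; rewrite !inE adj_sym.
have [i iE] := induced_inclusion S; have [j jE] := induced_inclusion (~: S).
have yS' : y \in ~: S by rewrite inE.
have [||] // := fi _ _ i j; last first.
- exact: induced_nontrivial yS'.
- exact: induced_nontrivial xS.
move=> L f g /=; split=> [|h h' [hi hj] [h'i h'j]]; last first.
  apply: raag_hom_ext => v; have [vS|vS] := boolP (v \in S).
    by have := hi (std_gen (exist _ v vS : induced S)); rewrite /= iE /= => ->;
       have := h'i (std_gen (exist _ v vS : induced S)); rewrite /= iE /= => ->.
  have vS' : v \in ~: S by rewrite inE.
  by have := hj (std_gen (exist _ v vS' : induced (~: S))); rewrite /= jE /= => ->;
     have := h'j (std_gen (exist _ v vS' : induced (~: S))); rewrite /= jE /= => ->.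
pose e v : L := if insub v is Some u then f (std_gen (u : induced S)) else
  if insub v is Some u then g (std_gen (u : induced (~: S))) else 1.
have [v w vw|h hE] := @raag_hom_exists Gamma L e.
  rewrite /e; case: insubP => [v' vS v'E|vS].
    have wS : w \in S by rewrite -(sep v w vw).
    by rewrite (insubT (mem S) wS);
       apply/gmulf_commute/gen_comm; rewrite /= /induced_adj v'E.
  have wS : w \notin S by rewrite -(sep v w vw).
  rewrite (@insubN _ (mem S) _ w wS).
  case: insubP => [v' _ v'E|_]; last exact/commute_sym/commute1.
  case: insubP => [w' _ w'E|_]; last exact: commute1.
  by apply/gmulf_commute/gen_comm; rewrite /= /induced_adj v'E w'E.
exists h; split; apply: raag_hom_ext => v /=.
  by rewrite iE hE /e valK.
rewrite jE hE /e insubN ?valK //.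
by have := valP v; rewrite inE.
Qed.

(** If all pairs across a cut are adjacent, then the group is the product of the
    groups of the two sides: the retractions onto them are the coordinates, and
    the inverse multiplies the two inclusions, whose images commute. *)
Lemma directly_irreducible_coconnected :
  directly_irreducible A ->
  cut_connected (fun v w : Gamma => ~~ adj v w) [set: Gamma].
Proof.
move=> di S x y _ _ xS yS; apply: contrapT => alledges.
have join v w : v \in S -> w \notin S -> adj v w.
  move=> vS wS; apply: contrapT => /negP vw.
  by apply: alledges; exists v, w; rewrite !inE.
have [i iE] := induced_inclusion S; have [j jE] := induced_inclusion (~: S).
have [p [pE p1]] := induced_retraction S.
have [q [qE q1]] := induced_retraction (~: S).
have yS' : y \in ~: S by rewrite inE.
have [||] // := di (raag (induced S)) (raag (induced (~: S))); last first.
- exact: induced_nontrivial yS'.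
- exact: induced_nontrivial xS.
have ijC a b : commute (i a) (j b).
  move: a; apply: (@raag_ind _ [set a | commute (i a) (j b)]) => [|v] /=.
    split=> [|a a' /= aC a'C] /=; first by rewrite hom1; apply/commute_sym/commute1.
    by rewrite homF; apply/commute_sym/commuteM/commuteV/commute_sym => //;
       apply: commute_sym.
  move: b; apply: (@raag_ind _ [set b | commute (i (std_gen v)) (j b)]) => [|w] /=.
    split=> [|b b' /= bC b'C] /=; first by rewrite hom1; apply: commute1.
    by rewrite homF; apply: commuteM => //; apply: commuteV.
  rewrite iE jE; apply/gen_comm/join; first exact: (valP v).
  by have := valP w; rewrite inE.
pose f (x : A) := (p x, q x).
have fM z t : f (z * t) = f z * f t by rewrite /f !gmulfM.
pose fm := isMultiplicative.Build A
  (raag (induced S) * raag (induced (~: S)))%type f fM.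
pose g (z : raag (induced S) * raag (induced (~: S))) := i z.1 * j z.2.
have gM z t : g (z * t) = g z * g t.
  rewrite /g !gmulfM -!mulgA; congr (_ * _); rewrite !mulgA; congr (_ * _).
  exact: ijC.
have pj b : p (j b) = 1.
  move: b; apply: (raag_hom_ext (h := p \o j) (h' := one_fun _)) => v /=.
  by rewrite jE p1 //; have := valP v; rewrite inE.
have qi a : q (i a) = 1.
  move: a; apply: (raag_hom_ext (h := q \o i) (h' := one_fun _)) => v /=.
  by rewrite iE q1 // inE negbK (valP v).
have pi a : p (i a) = a.
  by move: a; apply: (raag_hom_ext (h := p \o i) (h' := idfun)) => v /=; rewrite iE pE.
have qj a : q (j a) = a.
  by move: a; apply: (raag_hom_ext (h := q \o j) (h' := idfun)) => v /=; rewrite jE qE.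
exists (HB.pack_for {multiplicative A -> _} f fm), g => /= [z|[a b]].
  have gfM z1 z2 : g (f (z1 * z2)) = g (f z1) * g (f z2) by rewrite fM gM.
  pose gfm := isMultiplicative.Build A A (g \o f) gfM.
  pose gf : {multiplicative A -> A} :=
    HB.pack_for {multiplicative A -> A} (g \o f) gfm.
  move: z; apply: (raag_hom_ext (h := gf) (h' := idfun)) => v /=.
  rewrite /g /f /=; have [vS|vS] := boolP (v \in S).
    rewrite (pE (exist _ v vS : induced S)) q1 ?inE ?vS // hom1 mulg1.
    exact: iE.
  have vS' : v \in ~: S by rewrite inE.
  by rewrite (qE (exist _ v vS' : induced (~: S))) p1 // hom1 mul1g; apply: jE.
by rewrite /f /g /= !gmulfM pi pj qi qj mulg1 mul1g.
Qed.

(** With at most one vertex, all generators are equal to some g, and quotients of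
    powers of g form a subgroup. *)
Lemma noncyclic_two_vertices : ~ cyclic_group A -> exists v w : Gamma, v != w.
Proof.
move=> ncyc; apply: contrapT => one; apply: ncyc.
have cyc g : (forall v, gen v = g) ->
    forall x : A, exists n, x = g ^+ n \/ x = g ^- n.
  move=> gE.
  pose P : set A :=
    [set x | exists n m, x = g ^+ n / g ^+ m].
  have sP : is_subgroup P.
    split=> [|_ _ [n [m ->]] [n' [m' ->]]] /=; first by exists 0, 0; rewrite divg1.
    exists (n + m')%N, (n' + m)%N; rewrite invgF !expgnDr invgM !mulgA.
    have C k l : commute (g ^+ k) (g ^+ l) by apply: commuteX2.
    have CV k l : commute (g ^- k) (g ^+ l) by apply/commute_sym/commuteV.
    have CVV k l : commute (g ^- k) (g ^- l) by apply/commuteV/CV.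
    by rewrite -(mulgA _ (g ^- m)) (CV m m') mulgA -(mulgA _ (g ^- m)) (CVV m n') mulgA.
  have all : forall x, P x.
    apply: raag_ind => // v; exists 1%N, 0%N; rewrite gE expg1 divg1 //.
  move=> x; have [n [m ->]] := all x; have [le|lt] := leqP m n.
    by exists (n - m)%N; left; rewrite expgnFr.
  exists (m - n)%N; right; rewrite expgnFr ?invgF //; exact: ltnW.
have [[v]|noV] := pselect (inhabited Gamma).
  exists (gen v); apply: cyc => w; congr gen; apply: contrapT => /eqP wv.
  by apply: one; exists w, v.
exists 1; apply: cyc => v; case: noV; split; exact: v.
Qed.

End Irreducibility.
(** * Cores and their neighbourhoods *)

Section Cores.
Variable Gamma : sgraph.
Implicit Types (C D K : {set Gamma}) (v w : Gamma).

Definition nbhd C : {set Gamma} := [set v | [exists c in C, adj c v]]%SET.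

(** Connected sets that are not singletons: an element of C without a neighbour
    in C could be folded by a vertex outside [nbhd C]. *)
Definition core C : Prop := cut_connected (@adj Gamma) C /\ C \subset nbhd C.

Lemma nbhdP C v : reflect (exists2 c, c \in C & adj c v) (v \in nbhd C).
Proof. by rewrite inE; apply: exists_inP. Qed.

Lemma nbhdPn C v c : v \notin nbhd C -> c \in C -> ~~ adj c v.
Proof. by move=> vC cC; apply: contra vC => cv; apply/nbhdP; exists c. Qed.

Lemma coreU1 C d : core C -> d \in nbhd C -> core (d |: C)%SET.
Proof.
move=> [Ccut /fintype.subsetP CN] /nbhdP[c cC cd]; split; last first.
  apply/fintype.subsetP => v; rewrite in_setU1 => /predU1P[->|/CN/nbhdP[b bC bv]].
    by apply/nbhdP; exists c; rewrite // in_setU1 cC orbT.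
  by apply/nbhdP; exists b; rewrite // in_setU1 bC orbT.
move=> S x y xC yC xS yS.
have inU u : u \in C -> u \in (d |: C)%SET by rewrite in_setU1 orbC => ->.
have dU : d \in (d |: C)%SET by rewrite in_setU1 eqxx.
have cutC a b : a \in C -> b \in C -> a \in S -> b \notin S ->
    exists a b, [/\ a \in (d |: C)%SET, b \in (d |: C)%SET, a \in S, b \notin S
                 & adj a b].
  move=> aC bC aS bS; have [a' [b' [a'C b'C *]]] := Ccut S a b aC bC aS bS.
  by exists a', b'; split=> //; apply: inU.
have [dS|dS] := boolP (d \in S).
  have yC' : y \in C by move: yC yS; rewrite in_setU1 => /predU1P[->|//]; rewrite dS.
  have [cS|cS] := boolP (c \in S); first exact: (cutC c y).
  by exists d, c; split=> //; [exact: inU | rewrite adj_sym].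
have xC' : x \in C by move: xC xS dS; rewrite in_setU1 => /predU1P[-> ->|].
have [cS|cS] := boolP (c \in S); last exact: (cutC x c).
by exists c, d; split=> //; apply: inU.
Qed.

Lemma edge_core v w : adj v w -> core [set v; w]%SET.
Proof.
move=> vw; have wv : adj w v by rewrite adj_sym.
have inv : v \in [set v; w]%SET by rewrite set21.
have inw : w \in [set v; w]%SET by rewrite set22.
split; last first.
  by apply/fintype.subsetP => u /set2P[] ->; apply/nbhdP; [exists w | exists v].
move=> S x y /set2P[] -> /set2P[] -> xS yS.
- by rewrite xS in yS.
- by exists v, w.
- by exists w, v.
- by rewrite xS in yS.
Qed.

(** A neighbour of v in C would also be a neighbour of w. *)
Lemma core_fold C v w :
  w \notin nbhd C -> link v \subset link w -> v \notin nbhd C.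
Proof.
move=> wC /fintype.subsetP vw; apply/negP => /nbhdP[c cC cv].
have := vw c; rewrite !inE adj_sym cv => /(_ isT).
by rewrite adj_sym (negbTE (nbhdPn wC cC)).
Qed.

Lemma component_closed X K u v : component X K ->
  u \in K -> v \in X -> adj u v -> v \in K.
Proof.
move=> [c cX ->]; rewrite !inE => cu vX uv.
have uX : u \in X.
  case/connectP: cu => p; case/lastP: p => [_ -> //|p z].
  by rewrite rcons_path last_rcons => /andP[_ /=/and3P[_ zX _]] ->.
by apply: connect_trans cu (connect1 _); rewrite /= uX vX.
Qed.

Lemma component_star_notin K w : component (~: star w) K -> w \notin K.
Proof.
case=> c cX ->; rewrite inE; apply/negP => /connectP[p].
case/lastP: p => [_ /= wc|p z]; first by move: cX; rewrite -wc !inE eqxx.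
rewrite rcons_path last_rcons => /andP[_ /= /and3P[_ zX _]] wz.
by move: zX; rewrite -wz !inE eqxx.
Qed.

(** C misses the star of w, so once K meets [nbhd C] it meets C, hence contains C
    by connectedness, hence also every vertex of [nbhd C] outside the star. *)
Lemma core_component C K w : core C -> w \notin nbhd C ->
  component (~: star w) K ->
  (forall u, u \in nbhd C -> u \notin K) \/
  (forall u, u \in nbhd C -> u \in K \/ adj w u).
Proof.
move=> [Ccut /fintype.subsetP CN] wC Kcomp.
have offw u : u \in ~: star w = (u != w) && ~~ adj w u.
  by rewrite !inE negb_or.
have Coff c : c \in C -> c \in ~: star w.
  move=> cC; rewrite offw adj_sym (nbhdPn wC cC) andbT.
  by apply: contraNneq wC => <-; apply: CN.
have [meets|disj] := pselect (exists2 u, u \in nbhd C & u \in K); last first.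
  by left=> u uN; apply/negP => uK; apply: disj; exists u.
right; have [u /nbhdP[c cC cu] uK] := meets.
have cK : c \in K.
  by apply: component_closed Kcomp uK (Coff c cC) _; rewrite adj_sym.
have CK b : b \in C -> b \in K.
  move=> bC; apply: contrapT => /negP bK.
  have [a' [b' [_ b'C a'K b'K ab]]] := Ccut K c b cC bC cK bK.
  by move/negP: b'K; apply; apply: component_closed Kcomp a'K (Coff b' b'C) ab.
move=> v vN; have [wv|wv] := boolP (adj w v); [by right|left].
case/nbhdP: (vN) => b bC bv; apply: component_closed Kcomp (CK b bC) _ bv.
by rewrite offw wv andbT; apply: contraNneq wC => <-.
Qed.

(** D is a maximal core with non-dominating neighbourhood and C is an edge from
    the complement of [nbhd D] to the frontier B of D. Maximality joins B
    completely to that complement. *)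
Lemma exists_splitting_cores :
  cut_connected (@adj Gamma) [set: Gamma] ->
  cut_connected (fun v w : Gamma => ~~ adj v w) [set: Gamma] ->
  (exists v w : Gamma, v != w) ->
  exists C D,
  [/\ core C, core D, (exists p, p \notin nbhd C), (exists m, m \notin nbhd D) &
      forall p m, p \notin nbhd C -> m \notin nbhd D -> p != m /\ ~~ adj p m].
Proof.
move=> conn coconn [v [w vw]].
have wv : w \notin [set v]%SET by rewrite inE eq_sym.
have [v' [y [_ _ /set1P -> _ vy]]] :=
  conn _ v w (finset.in_setT _) (finset.in_setT _) (set11 v) wv.
have vS : v \in ~: link v by rewrite !inE adj_irrefl.
have yS : y \notin ~: link v by rewrite !inE negbK.
have [x [y' [_ _ vx vy' xy']]] :=
  coconn _ v y (finset.in_setT _) (finset.in_setT _) vS yS.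
(* x is adjacent to neither end of the edge from v to y'. *)
rewrite !inE ?negbK in vx vy'.
pose good D := `[< core D /\ exists m, m \notin nbhd D >].
have gvy : good [set v; y']%SET.
  apply/asboolP; split; first exact: edge_core.
  exists x; apply/nbhdP => -[_ /set2P[]->]; first by rewrite (negbTE vx).
  by rewrite adj_sym (negbTE xy').
have [D /maxsetP[/asboolP[Dcore [m mD]] Dmax] sD] := maxset_exists gvy.
have [_ /fintype.subsetP DN] := Dcore.
pose B : {set Gamma} := nbhd D :\: D.
have Bjoin b z : b \in B -> z \notin nbhd D -> adj b z.
  rewrite inE => /andP[bD bN] zD; apply: contrapT => /negP bz.
  have : good (b |: D)%SET.
    apply/asboolP; split; first exact: coreU1.
    exists z; apply/nbhdP => -[c /setU1P[->|cD]]; first by rewrite (negbTE bz).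
    by rewrite (negbTE (nbhdPn zD cD)).
  move/Dmax => /(_ (finset.subsetUr _ _)) DE.
  by move: bD; rewrite -DE in_setU1 eqxx.
have vD : v \in D by apply: (fintype.subsetP sD); rewrite set21.
have [d [n0 [_ _ dD n0D dn0]]] := conn D v m (finset.in_setT _) (finset.in_setT _) vD
  (contra (DN m) mD).
have n0B : n0 \in B by rewrite !inE n0D; apply/exists_inP; exists d.
have mB : m \notin B by rewrite inE (negbTE mD) andbF.
(* B is nonempty and misses m, so it is a cut for the complement graph. *)
have [n [z [_ _ nB zB nz]]] :=
  coconn B n0 m (finset.in_setT _) (finset.in_setT _) n0B mB.
have zD : z \in D.
  apply: contrapT => /negP zD; have zN : z \in nbhd D.
    by apply: contrapT => /negP zN; rewrite (Bjoin n z) in nz.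
  by rewrite inE zD zN in zB.
exists [set m; n]%SET, D; split=> //.
- by apply: edge_core; rewrite adj_sym; apply: Bjoin.
- exists z; apply/nbhdP => -[c /set2P[]->]; last by rewrite (negbTE nz).
  by rewrite adj_sym (negbTE (nbhdPn mD zD)).
- by exists m.
move=> p m' pC m'D; suff pD : p \in D.
  split; last exact: nbhdPn m'D pD.
  by apply: contraNneq m'D => <-; apply: DN.
apply: contrapT => /negP pD; move/negP: pC; apply; apply/nbhdP.
have [pN|pN] := boolP (p \in nbhd D).
  by exists m; rewrite ?set21 // adj_sym; apply: Bjoin; rewrite // inE pD.
by exists n; rewrite ?set22 //; apply: Bjoin.
Qed.

End Cores.

(** * The amalgamated product *)

Section Amalgam.
Variables (Gamma : sgraph) (Dp Dm : {set Gamma}).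
Local Notation A := (raag Gamma).
Local Notation gen := (@std_gen Gamma).

(** Both generators of each defining relation lie on one of the two sides, where
    the given homomorphism already satisfies the relation. *)
Lemma std_parabolic_amalgam :
  (forall v w, adj v w -> (v \in Dp) && (w \in Dp) || (v \in Dm) && (w \in Dm)) ->
  (forall v, (v \in Dp) || (v \in Dm)) ->
  is_amalgam (std_parabolic (Dp :&: Dm)) (std_parabolic Dp) (std_parabolic Dm).
Proof.
move=> edges cover; split; first by split; apply: std_parabolic_subgroup.
- by apply: std_parabolicS; apply: finset.subsetIl.
- by apply: std_parabolicS; apply: finset.subsetIr.
move=> L f g fM gM fg /=; split=> [|h h' [hp hm] [h'p h'm]]; last first.
  apply: raag_hom_ext => v; have /orP[vD|vD] := cover v.
    by rewrite hp ?h'p //; apply: std_parabolic_gen.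
  by rewrite hm ?h'm //; apply: std_parabolic_gen.
pose e v := if v \in Dp then f (gen v) else g (gen v).
have eE v : v \in Dm -> e v = g (gen v).
  rewrite /e => vm; case: ifP => // vp; apply: fg.
  by apply: std_parabolic_gen; rewrite inE vp.
have comm D k : multiplicative_on (std_parabolic D) k ->
    forall v w, adj v w -> v \in D -> w \in D -> commute (k (gen v)) (k (gen w)).
  move=> kM v w vw vD wD; rewrite /commute -!kM; try exact: std_parabolic_gen.
  by rewrite gen_comm.
have [v w vw|h hE] := @raag_hom_exists _ _ e.
  have /orP[/andP[vD wD]|/andP[vD wD]] := edges v w vw.
    by rewrite /e vD wD; apply: comm fM _ _ vw vD wD.
  by rewrite !eE //; apply: comm gM _ _ vw vD wD.
have extends D k : multiplicative_on (std_parabolic D) k ->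
    (forall v, v \in D -> e v = k (gen v)) ->
    forall x, std_parabolic D x -> h x = k x.
  move=> kM ek x xD.
  have sP := multiplicative_on_subgroup h (@std_parabolic_subgroup _ D) kM.
  have [] // := std_parabolic_min sP _ xD.
  by move=> v vD /=; split; [exact: std_parabolic_gen | rewrite hE ek].
exists h; split; apply: extends => // v vD.
by rewrite /e vD.
Qed.

Lemma std_parabolic_splitting :
  (forall v w, adj v w -> (v \in Dp) && (w \in Dp) || (v \in Dm) && (w \in Dm)) ->
  (forall v, (v \in Dp) || (v \in Dm)) ->
  (exists p, p \notin Dm) -> (exists m, m \notin Dp) ->
  amalgam_splitting
    (std_parabolic (Dp :&: Dm)) (std_parabolic Dp) (std_parabolic Dm).
Proof.
move=> edges cover [p pm] [m mp]; split; first exact: std_parabolic_amalgam.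
  move=> E; apply: (@notin_std_parabolic _ (Dp :&: Dm) p).
    by rewrite inE negb_and pm orbT.
  by rewrite E; apply: std_parabolic_gen; have := cover p; rewrite (negbTE pm) orbF.
move=> E; apply: (@notin_std_parabolic _ (Dp :&: Dm) m).
  by rewrite inE negb_and mp.
by rewrite E; apply: std_parabolic_gen; have := cover m; rewrite (negbTE mp).
Qed.

End Amalgam.
(** * Automorphisms that preserve a subgroup up to conjugacy *)

Section Carries.
Variable G : groupType.
Implicit Types (phi psi : aut G) (g : G) (A : set G).

(** The automorphism x |-> phi(x)^g maps A onto itself, that is, phi(A) is the
    conjugate g A g^-1. The equivalence expresses surjectivity without an
    existential, which makes composition and inversion immediate. *)
Definition carries phi g A : Prop := forall x, A (phi x ^ g) <-> A x.

Lemma aut_1 phi : phi 1 = 1.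
Proof. exact: hom1. Qed.

Lemma autF phi x y : phi (x / y) = phi x / phi y.
Proof. exact: homF. Qed.

Lemma autV phi x : phi x^-1 = (phi x)^-1.
Proof. exact: homV. Qed.

Lemma autJ phi x y : phi (x ^ y) = phi x ^ phi y.
Proof. exact: homJ. Qed.

Lemma carries1 A : carries 1 1 A.
Proof. by move=> x; rewrite conjg1. Qed.

Lemma carriesM phi psi g k A : carries phi g A -> carries psi k A ->
  carries (phi * psi) (phi k * g) A.
Proof.
move=> phiA psiA x; rewrite -(psiA x) -(phiA (psi x ^ k)).
by rewrite autJ conjgM.
Qed.

Lemma autVK phi x : phi^-1 (phi x) = x.
Proof. exact: (aut_invK phi).1. Qed.

Lemma autKV phi x : phi (phi^-1 x) = x.
Proof. exact: (aut_invK phi).2. Qed.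

Lemma carriesV phi g A : carries phi g A -> carries phi^-1 (phi^-1 g^-1) A.
Proof. by move=> phiA x; rewrite -autJ -phiA autKV conjgKV. Qed.

Lemma carries_sub phi g A : is_subgroup A -> A g -> carries phi 1 A ->
  carries phi g A.
Proof.
by move=> sA Ag phiA x; rewrite (subgroupJ _ sA Ag) -(phiA x) conjg1.
Qed.

(** The map X |-> phi(X) g acts on cosets because phi(xA) g is equal to
    phi(x) g (phi(A)^g). *)
Lemma carries_lcoset phi g A x : carries phi g A ->
  [set phi y * g | y in lcoset_set x A] = lcoset_set (phi x * g) A.
Proof.
move=> phiA; apply/seteqP; split=> [_ [_ [a Aa <-] <-]|_ [b Ab <-]].
  exists (phi a ^ g); first exact/phiA.
  by rewrite conjgE autM !mulgA mulgK.
exists (x * phi^-1 (b ^ g^-1)).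
  by exists (phi^-1 (b ^ g^-1)) => //; apply/phiA; rewrite autKV conjgKV.
by rewrite autM autKV conjgE invgK !mulgA mulgVK.
Qed.

End Carries.

Section CarriesParabolic.
Variable Gamma : sgraph.
Local Notation A := (raag Gamma).
Local Notation gen := (@std_gen Gamma).
Implicit Types (phi : aut A) (v w : Gamma) (Delta : {set Gamma}).

Lemma carries_std_parabolic phi g Delta :
  (forall v, v \in Delta -> std_parabolic Delta (phi (gen v) ^ g)) ->
  (forall v, v \in Delta ->
     exists2 a, std_parabolic Delta a & phi a ^ g = gen v) ->
  carries phi g (std_parabolic Delta).
Proof.
move=> into onto; have sD := std_parabolic_subgroup Delta.
have fwd : std_parabolic Delta `<=` [set x | std_parabolic Delta (phi x ^ g)].
  apply: std_parabolic_min => //; split=> [|x y /= xD yD].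
    by rewrite /= aut_1 conj1g; case: sD.
  by rewrite autF conjMg conjVg; case: sD => _; apply.
have bwd : std_parabolic Delta `<=`
    [set x | exists2 a, std_parabolic Delta a & phi a ^ g = x].
  apply: std_parabolic_min => //.
  split=> [|_ _ [a aD <-] [b bD <-]] /=.
    by exists 1; [case: sD | rewrite aut_1 conj1g].
  exists (a / b); first by case: sD => _; apply.
  by rewrite autF conjMg conjVg.
move=> x; split=> [/bwd [a aD]|]; last exact: fwd.
by move/conjg_inj/(bij_inj (aut_bij phi)) => <-.
Qed.

Lemma carries_fixed phi Delta :
  (forall v, v \in Delta -> phi (gen v) = gen v) ->
  carries phi 1 (std_parabolic Delta).
Proof.
move=> fixD; apply: carries_std_parabolic => v vD.
  by rewrite conjg1 fixD //; apply: std_parabolic_gen.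
by exists (gen v); [exact: std_parabolic_gen | rewrite conjg1 fixD].
Qed.

Lemma carries_inversion phi v Delta :
  phi (gen v) = (gen v)^-1 -> (forall u, u != v -> phi (gen u) = gen u) ->
  carries phi 1 (std_parabolic Delta).
Proof.
move=> phiv phiu; have sD := std_parabolic_subgroup Delta.
apply: carries_std_parabolic => u uD; have Du := std_parabolic_gen uD.
  have [uv|uv] := eqVneq u v; last by rewrite conjg1 phiu.
  by rewrite conjg1 uv phiv -uv; apply: (subgroupV sD).
have [uv|uv] := eqVneq u v; last by exists (gen u); rewrite ?conjg1 ?phiu.
exists (gen u)^-1; first exact: (subgroupV sD).
by rewrite conjg1 autV uv phiv invgK.
Qed.

Lemma carries_fold phi v w Delta :
  v != w -> phi (gen v) = gen v * gen w ->
  (forall u, u != v -> phi (gen u) = gen u) ->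
  w \in Delta -> carries phi 1 (std_parabolic Delta).
Proof.
move=> vw phiv phiu wD; have sD := std_parabolic_subgroup Delta.
have Dw := std_parabolic_gen wD.
apply: carries_std_parabolic => u uD; have Du := std_parabolic_gen uD.
  rewrite conjg1; have [uv|uv] := eqVneq u v; last by rewrite phiu.
  by rewrite uv phiv -uv; apply: (subgroupM sD).
have [uv|uv] := eqVneq u v; last by exists (gen u); rewrite ?conjg1 ?phiu.
exists (gen u / gen w); first by case: sD => _; apply.
by rewrite conjg1 autF uv phiv phiu 1?eq_sym // mulgK.
Qed.

Section PartialConjugation.
Variables (phi : aut A) (w : Gamma) (K : {set Gamma}).
Hypothesis phiK : forall u, u \in K -> phi (gen u) = (gen w)^-1 * gen u * gen w.
Hypothesis phiNK : forall u, u \notin K -> phi (gen u) = gen u.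

Lemma carries_partial_conjugation Delta :
  w \notin K -> w \in Delta -> carries phi 1 (std_parabolic Delta).
Proof.
move=> wK wD; have sD := std_parabolic_subgroup Delta.
have Dw := std_parabolic_gen wD.
have phiKJ u : u \in K -> phi (gen u) = gen u ^ gen w.
  by move=> uK; rewrite phiK // conjgE mulgA.
apply: carries_std_parabolic => u uD; have Du := std_parabolic_gen uD.
  rewrite conjg1; have [uK|uK] := boolP (u \in K); last by rewrite phiNK.
  by rewrite phiKJ //; apply/(subgroupJ _ sD Dw).
have [uK|uK] := boolP (u \in K); last by exists (gen u); rewrite ?conjg1 ?phiNK.
exists (gen u ^ (gen w)^-1); first exact/(subgroupJ _ sD (subgroupV sD Dw)).
by rewrite conjg1 autJ autV (phiNK wK) (phiKJ u uK) conjgK.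
Qed.

Lemma carries_full_conjugation Delta :
  (forall u, u \in Delta -> u \in K \/ adj w u) ->
  carries phi (gen w)^-1 (std_parabolic Delta).
Proof.
move=> DK; have E u : u \in Delta -> phi (gen u) ^ (gen w)^-1 = gen u.
  move=> uD; have [uK|uK] := boolP (u \in K).
    by rewrite phiK // -mulgA -conjgE conjgK.
  have [|wu] := DK u uD; first by rewrite (negbTE uK).
  by rewrite phiNK // conjgE invgK mulgA gen_comm // mulgK.
apply: carries_std_parabolic => u uD; have Du := std_parabolic_gen uD.
  by rewrite E.
by exists (gen u); rewrite ?E.
Qed.

(** On subsets of [nbhd C] the automorphism is the identity or conjugation by w;
    in the second case, w lies in the parabolic subgroup on Delta', so that
    the same conjugator serves there as well. *)
Lemma core_partial_conjugation C Delta' :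
  component (~: star w) K -> core C -> w \notin nbhd C -> w \in Delta' ->
  exists g, carries phi g (std_parabolic Delta') /\
    forall Delta, Delta \subset nbhd C -> carries phi g (std_parabolic Delta).
Proof.
move=> Kcomp Ccore wC wD'.
have wK := component_star_notin Kcomp.
have phiD' := carries_partial_conjugation wK wD'.
have [disj|full] := core_component Ccore wC Kcomp.
  exists 1; split=> // Delta /fintype.subsetP DC.
  by apply: carries_fixed => u /DC/disj/phiNK.
exists (gen w)^-1; split=> [|Delta /fintype.subsetP DC].
  have sD' := std_parabolic_subgroup Delta'.
  exact: carries_sub sD' (subgroupV sD' (std_parabolic_gen wD')) phiD'.
by apply: carries_full_conjugation => u /DC/full.
Qed.

End PartialConjugation.

Section CoreSplitting.
Variables C D : {set Gamma}.
Hypotheses (Ccore : core C) (Dcore : core D).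
Hypothesis cover : forall v, (v \in nbhd C) || (v \in nbhd D).

(** One conjugator for all three subgroups: such a phi moves the base edge of the
    Bass--Serre tree, together with its endpoints, to a translate of it. *)
Definition preserves_splitting phi : Prop := exists g,
  [/\ carries phi g (std_parabolic (nbhd D :&: nbhd C)),
      carries phi g (std_parabolic (nbhd D)) &
      carries phi g (std_parabolic (nbhd C))].

(** If the acting vertex w lies on both sides, then it lies in the intersection
    and phi preserves all three subgroups. Otherwise the side that misses w is
    rigid: phi acts on it trivially or as conjugation by w, and in the second
    case w belongs to the other side, which phi preserves. *)
Lemma U0_generator_carries phi :
  inversion phi \/ partial_conjugation phi \/ fold phi -> preserves_splitting phi.
Proof.
case=> [[v [phiv phiu]]|[]].
- by exists 1; split; apply: carries_inversion phiv phiu.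
- case=> w [K [Kcomp phiK phiNK]].
  have [wC|wC] := boolP (w \in nbhd C); last first.
    have wD : w \in nbhd D by have := cover w; rewrite (negbTE wC).
    have [g [phiD phiC]] := core_partial_conjugation phiK phiNK Kcomp Ccore wC wD.
    by exists g; split=> //; apply: phiC => //; apply: finset.subsetIr.
  have [wD|wD] := boolP (w \in nbhd D); last first.
    have [g [phiC phiD]] := core_partial_conjugation phiK phiNK Kcomp Dcore wD wC.
    by exists g; split=> //; apply: phiD => //; apply: finset.subsetIl.
  have wK := component_star_notin Kcomp.
  exists 1; split; apply: (carries_partial_conjugation phiK phiNK) => //.
  by rewrite inE wD.
case=> v [w [vw _ lkvw phiv phiu]]; exists 1.
(* The last premise excludes the one bad case, in which the fold changes a
   generator of Delta by a generator outside Delta. *)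
have all E Delta : core E -> Delta \subset nbhd E ->
    (w \in nbhd E -> w \in Delta \/ v \notin Delta) ->
    carries phi 1 (std_parabolic Delta).
  move=> Ecore /fintype.subsetP DE wE.
  have out : v \notin Delta -> carries phi 1 (std_parabolic Delta).
    move=> vD; apply: carries_fixed => u uD; apply: phiu.
    by apply: contraNneq vD => <-.
  have [wE'|wE'] := boolP (w \in nbhd E).
    by case: (wE wE') => // wD; apply: carries_fold vw phiv phiu wD.
  by apply: out; apply: contra (core_fold wE' lkvw) => /DE.
split; [|by apply: (all D) => //; left|by apply: (all C) => //; left].
apply: (all D) => //; first exact: finset.subsetIl.
move=> wD; have [wC|wC] := boolP (w \in nbhd C); first by left; rewrite inE wD.
by right; rewrite inE negb_and (core_fold wC lkvw) orbT.
Qed.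

Lemma U0_carries phi : U0 phi -> preserves_splitting phi.
Proof.
have sE : is_subgroup (preserves_splitting : set (aut A)).
  split=> [|x y [g [x0 xp xm]] [k [y0 yp ym]]].
    by exists 1; split; apply: carries1.
  by exists (x (y^-1 k^-1) * g); split; apply: carriesM => //; apply: carriesV.
by move/(generated_min sE); apply => psi /= /U0_generator_carries.
Qed.

End CoreSplitting.

End CarriesParabolic.

(** * The induced isometry of the Bass--Serre tree *)

Section GraphIsometry.
Variables (V : Type) (E : V -> V -> Prop).

Lemma graph_automorphism_isometry (f f' : V -> V) :
  cancel f f' -> cancel f' f ->
  (forall x y, E x y -> E (f x) (f y)) ->
  (forall x y, E x y -> E (f' x) (f' y)) ->
  graph_isometry E f.
Proof.
have walk_map h : (forall x y, E x y -> E (h x) (h y)) ->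
    forall n x y, walk E n x y -> walk E n (h x) (h y).
  move=> hE n x y; elim=> [z|m z t u zt _ IH]; first exact: Walk0.
  exact: WalkS (hE _ _ zt) IH.
move=> fK f'K /walk_map fE /walk_map f'E; split; first by exists f'.
have walkE n x y : walk E n (f x) (f y) <-> walk E n x y.
  by split=> [/f'E|/fE //]; rewrite !fK.
move=> x y n; split=> -[xy min]; split; try exact/walkE.
  by move=> m /walkE/min.
by move=> m /walkE/min.
Qed.

End GraphIsometry.

Section BassSerreMap.
Variables (G : groupType) (A0 Ap Am : set G).

Lemma bs_vertex_eq (x y : bs_vertex Ap Am) :
  bs_type x = bs_type y -> bs_coset x = bs_coset y -> x = y.
Proof.
case: x y => [s X pX] [t Y pY] /= st XY; case: _ / st pY => pY.
by case: _ / XY pY => pY; congr BSVertex; apply: Prop_irrelevance.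
Qed.

Section Map.
Variables (phi : aut G) (g : G).
Hypotheses (phi0 : carries phi g A0) (phip : carries phi g Ap)
  (phim : carries phi g Am).

Lemma bs_map_subproof (x : bs_vertex Ap Am) :
  exists h, [set phi y * g | y in bs_coset x] =
    lcoset_set h (bs_side Ap Am (bs_type x)).
Proof.
by case: x => -[] X /= [h ->]; exists (phi h * g); apply: carries_lcoset.
Qed.

Definition bs_map (x : bs_vertex Ap Am) : bs_vertex Ap Am :=
  BSVertex (bs_map_subproof x).

Lemma bs_map_adj x y : bs_adj A0 Ap Am x y -> bs_adj A0 Ap Am (bs_map x) (bs_map y).
Proof.
move=> [xy [[e [h eh]] [/= ex ey]]]; split=> //=.
have he : exists h, [set phi y * g | y in e] = lcoset_set h A0.
  by exists (phi h * g); rewrite eh carries_lcoset.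
by exists (BSEdge he); split=> _ [z /= ez <-]; exists z => //; [apply: ex | apply: ey].
Qed.

Lemma bs_map_act h x : bs_map (bs_act h x) = bs_act (phi h) (bs_map x).
Proof.
apply: bs_vertex_eq => //=; apply/seteqP; split=> [_ [_ [z xz <-] <-]|].
  by exists (phi z * g); [exists z | rewrite autM mulgA].
move=> _ [_ [z xz <-] <-]; exists (h * z); first by exists z.
by rewrite autM mulgA.
Qed.

End Map.

Lemma bs_map_isometry (phi : aut G) (g : G) (phip : carries phi g Ap)
  (phim : carries phi g Am) :
  carries phi g A0 -> graph_isometry (bs_adj A0 Ap Am) (bs_map phip phim).
Proof.
move=> phi0; pose inv := bs_map (carriesV phip) (carriesV phim).
apply: (@graph_automorphism_isometry _ _ _ inv).
- move=> x; apply: bs_vertex_eq => //=; apply/seteqP; split=> [_ [_ [z xz <-] <-]|z xz].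
    by rewrite autM autVK autV mulgK.
  by exists (phi z * g); [exists z | rewrite autM autVK autV mulgK].
- move=> x; apply: bs_vertex_eq => //=; apply/seteqP; split=> [_ [_ [z xz <-] <-]|z xz].
    by rewrite autM !autKV mulgVK.
  by exists (phi^-1 z * phi^-1 g^-1); [exists z | rewrite autM !autKV mulgVK].
- by move=> x y; apply: bs_map_adj.
- by move=> x y; apply: bs_map_adj; apply: carriesV.
Qed.

End BassSerreMap.

Theorem proposition4 (Gamma : sgraph) :
  directly_irreducible (raag Gamma) ->
  freely_irreducible (raag Gamma) ->
  ~ cyclic_group (raag Gamma) ->
  exists A0 Ap Am : set (raag Gamma),
    [/\ parabolic A0, parabolic Ap & parabolic Am] /\
    amalgam_splitting A0 Ap Am /\
    (forall phi : aut (raag Gamma), U0 phi ->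
       exists f : bs_vertex Ap Am -> bs_vertex Ap Am,
         graph_isometry (bs_adj A0 Ap Am) f /\
         (forall (g : raag Gamma) (x : bs_vertex Ap Am),
            f (bs_act g x) = bs_act (phi g) (f x))).
Proof.
move=> di fi ncyc.
have [C [D [Ccore Dcore outC outD sep]]] := exists_splitting_cores
  (freely_irreducible_connected fi) (directly_irreducible_coconnected di)
  (noncyclic_two_vertices ncyc).
have cover v : (v \in nbhd C) || (v \in nbhd D).
  by apply: contraT; rewrite negb_or => /andP[vC /(sep v v vC)[]]; rewrite eqxx.
exists (std_parabolic (nbhd D :&: nbhd C)), (std_parabolic (nbhd D)),
  (std_parabolic (nbhd C)).
split; first by split; apply: std_parabolic_parabolic.
split.
  apply: std_parabolic_splitting => // [v w vw|v]; last by rewrite orbC.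
  have [vC|vC] := boolP (v \in nbhd C); have [wC|wC] := boolP (w \in nbhd C);
    rewrite ?andbT ?andbF ?orbT ?orbF //; have := cover v; have := cover w;
    rewrite ?(negbTE vC) ?(negbTE wC) /=.
  - move=> wD _; rewrite wD andbT; apply: contraT => vD.
    by have [_] := sep w v wC vD; rewrite adj_sym vw.
  - move=> _ vD; rewrite vD /=; apply: contraT => wD.
    by have [_] := sep v w vC wD; rewrite vw.
  - by move=> -> ->.
move=> phi /(U0_carries Ccore Dcore cover)[g [phi0 phip phim]].
exists (bs_map phip phim); split; first exact: bs_map_isometry.
exact: bs_map_act.
Qed.
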